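(* Let $m,n$ be positive integers and let $c,z,u_1,\dots,u_n,v_1,\dots,v_m$ be complex parameters in general position, with $z\ne1$ if $n>m$. (I) For additional parameters $\eta_1,\dots,\eta_m$ (in general position), $$F_{n,m}^{(z)}(\overline u|\overline v)=\frac{1}{\prod_{1\le i<j\le m}(v_j-v_i)(\eta_i-\eta_j)}\det_{1\le i,j\le m}\Bigg(\prod_{k=1,k\ne j}^m(v_i-\eta_k)-z\prod_{k=1,k\ne j}^m(v_i-\eta_k-c)\prod_{k=1}^n\frac{v_i-u_k}{v_i-u_k-c}\Bigg).$$ (II) For additional parameters $\eta_1,\dots,\eta_n$ (in general position), $$G_{n,m}^{(z)}(\overline u|\overline v)=(1-z)^{m-n}\frac{1}{\prod_{1\le i<j\le n}(u_j-u_i)(\eta_i-\eta_j)}\det_{1\le i,j\le n}\Bigg(\prod_{k=1,k\ne j}^n(u_i-\eta_k)-z\prod_{k=1,k\ne j}^n(u_i-\eta_k+c)\prod_{k=1}^m\frac{u_i-v_k}{u_i-v_k+c}\Bigg).$$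
   Context: Write $[1,\dots,n]=\{1,\dots,n\}$, $|K|$ for the cardinality of a set $K$, $\overline u=\{u_1,\dots,u_n\}$, $\overline v=\{v_1,\dots,v_m\}$; $j\notin K$ means $j$ lies in the complement of $K$ in the index set over which subsets are taken. The rational source functions are $$F_{n,m}^{(z)}(\overline u|\overline v)=\sum_{K\subset[1,\dots,m]}(-z)^{|K|}\prod_{i\in K,\,j\notin K}\frac{v_i-v_j-c}{v_i-v_j}\prod_{i\in K,\,1\le k\le n}\frac{v_i-u_k}{v_i-u_k-c},$$ $$G_{n,m}^{(z)}(\overline u|\overline v)=(1-z)^{m-n}\sum_{K\subset[1,\dots,n]}(-z)^{|K|}\prod_{i\in K,\,j\notin K}\frac{u_i-u_j+c}{u_i-u_j}\prod_{i\in K,\,1\le k\le m}\frac{u_i-v_k}{u_i-v_k+c}.$$ ''In general position'' means that zeros of all factors in denominators are avoided. *)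

(* Defs.v *)
From HB Require Import structures.
From mathcomp Require Import all_boot all_order all_algebra.

Set Implicit Arguments.
Unset Strict Implicit.
Unset Printing Implicit Defensive.

Import GRing.Theory.
Local Open Scope ring_scope.

Definition sourceF (C : fieldType) (n m : nat) (c z : C)
    (u : 'I_n -> C) (v : 'I_m -> C) : C :=
  \sum_(K : {set 'I_m})
    (- z) ^+ #|K|
    * (\prod_(i in K) \prod_(j | j \notin K) ((v i - v j - c) / (v i - v j)))
    * (\prod_(i in K) \prod_(k < n) ((v i - u k) / (v i - u k - c))).

Definition sourceG (C : fieldType) (n m : nat) (c z : C)
    (u : 'I_n -> C) (v : 'I_m -> C) : C :=
  (1 - z) ^ (m%:Z - n%:Z) *
  \sum_(K : {set 'I_n})
    (- z) ^+ #|K|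
    * (\prod_(i in K) \prod_(j | j \notin K) ((u i - u j + c) / (u i - u j)))
    * (\prod_(i in K) \prod_(k < m) ((u i - v k) / (u i - v k + c))).

(* Main.v *)
Require Import Defs.
From HB Require Import structures.
From mathcomp Require Import all_boot all_order all_algebra.
From mathcomp Require Import reals complex.

Set Implicit Arguments.
Unset Strict Implicit.
Unset Printing Implicit Defensive.

Import GRing.Theory.
Local Open Scope ring_scope.

(** Both identities are one statement about a field: for pairwise distinct
    points [w i], pairwise distinct nodes [eta j], a shift [d] and arbitrary
    weights [t i],
    [\sum_K \prod_(i in K) t i * \prod_(i in K, j \notin K)
       (w i - w j - d) / (w i - w j)]
    is the quotient of
    [\det (\prod_(k != j) (w i - eta k) + t i * \prod_(k != j) (w i - d - eta k))]
    by [\prod_(i < j) (w j - w i) * (eta i - eta j)].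

    The determinant is multilinear in its rows, so it is a sum over the sets [K]
    of rows in which the second summand is chosen ([det_row_addE]).  The term of
    [K] is [\prod_(i in K) t i] times the determinant of the matrix
    [\prod_(k != j) (x i - eta k)] at the points [x] obtained from [w] by
    shifting those with index in [K].  Its columns are polynomials of degree less
    than the size of the matrix evaluated at the [x i], so it factors through the
    Vandermonde matrix of [x] ([det_nodal]).  In the ratio of the Vandermonde
    products of [x] and [w], only the pairs with exactly one index in [K]
    survive, since a common shift does not change a difference
    ([Vandermonde_shift_ratio]).

    The function F is the case [w = v], [d = c], and G is the case [w = u],
    [d = - c]; in both, the weight [t i] is [- z] times the remaining rational
    product attached to [i]. *)

Lemma prod_pairs_lt (C : comPzRingType) (n : nat) (g : 'I_n -> 'I_n -> C) :
  (forall i, g i i = 1) ->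
  \prod_(i < n) \prod_(j < n) g i j
    = \prod_(i < n) \prod_(j < n | (i < j)%N) (g i j * g j i).
Proof.
move=> gii.
transitivity (\prod_(i < n) ((\prod_(j < n | (i < j)%N) g i j)
                             * \prod_(j < n | (j < i)%N) g i j)).
  apply: eq_bigr => i _; rewrite (bigID (fun j : 'I_n => (i < j)%N)) /=.
  congr (_ * _); rewrite (bigD1 i) ?ltnn //= gii mul1r.
  by apply: eq_bigl => j; rewrite -leqNgt ltn_neqAle andbC.
rewrite big_split /= [X in _ * X](exchange_big_dep xpredT) //= -big_split /=.
by apply: eq_bigr => i _; rewrite big_split.
Qed.

Lemma det_row_addE (C : comPzRingType) (n : nat) (A B : 'M[C]_n) :
  \det (A + B)
    = \sum_(K : {set 'I_n})
        \det (\matrix_(i, j) (if i \in K then B i j else A i j)).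
Proof.
rewrite /determinant exchange_big /=; apply: eq_bigr => s _.
rewrite -mulr_sumr; congr (_ * _).
under eq_bigr do rewrite mxE addrC.
rewrite bigA_distr; apply: eq_bigr => K _; apply: eq_bigr => i _.
by rewrite mxE.
Qed.

(** Expanding the columns in powers of [x i] writes the matrix as the transposed
    Vandermonde matrix of [x] times a coefficient matrix depending only on
    [eta].  The determinant of the latter is found by specialising to
    [x = eta], where the matrix is diagonal. *)
Lemma det_nodal (C : fieldType) (n : nat) (x eta : 'I_n -> C) :
  (forall i j, i != j -> eta i - eta j != 0) ->
  \det (\matrix_(i < n, j < n) \prod_(k < n | k != j) (x i - eta k))
    = \prod_(i < n) \prod_(j < n | (i < j)%N) ((x j - x i) * (eta i - eta j)).
Proof.
move=> eta_inj.
pose p (j : 'I_n) : {poly C} := \prod_(k < n | k != j) ('X - (eta k)%:P).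
pose M : 'M[C]_n := \matrix_(l, j) (p j)`_l.
have size_p j : (size (p j) <= n)%N.
  rewrite /p -big_filter size_prod_XsubC -cardE.
  rewrite (eq_card (B := predC1 j)) // cardC1 card_ord prednK //.
  exact: leq_ltn_trans (ltn_ord j).
have factor (y : 'I_n -> C) :
    \matrix_(i < n, j < n) \prod_(k < n | k != j) (y i - eta k)
    = (Vandermonde n (\row_i y i))^T *m M.
  apply/matrixP=> i j; rewrite !mxE.
  transitivity (p j).[y i].
    by rewrite horner_prod; apply: eq_bigr => k _; rewrite !hornerE.
  rewrite (horner_coef_wide _ (size_p j)); apply: eq_bigr => l _.
  by rewrite !mxE mulrC.
have detV (y : 'I_n -> C) : \det (Vandermonde n (\row_i y i))
    = \prod_(i < n) \prod_(j < n | (i < j)%N) (y j - y i).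
  rewrite det_Vandermonde; apply: eq_bigr => i _; apply: eq_bigr => j _.
  by rewrite !mxE.
have detM : \det M = \prod_(i < n) \prod_(j < n | (i < j)%N) (eta i - eta j).
  have Vn0 : \prod_(i < n) \prod_(j < n | (i < j)%N) (eta j - eta i) != 0.
    apply/prodf_neq0 => i _; apply/prodf_neq0 => j lt_ij.
    by apply: eta_inj; rewrite eq_sym neq_ltn lt_ij.
  apply: (mulfI Vn0); rewrite -{1}detV -det_tr -det_mulmx -factor.
  (* The diagonal entry [g i i] is set to [1] so that the ordered pairs of
     distinct indices become a full double product. *)
  rewrite -big_split /=; under [RHS]eq_bigr do rewrite -big_split /=.
  pose g i j := if j == i then 1 else eta i - eta j.
  transitivity (\prod_(i < n) \prod_(j < n) g i j).
    have -> : \matrix_(i < n, j < n) \prod_(k < n | k != j) (eta i - eta k)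
        = diag_mx (\row_i \prod_(k < n | k != i) (eta i - eta k)).
      apply/matrixP=> i j; rewrite !mxE.
      have [->|ne_ij] := eqVneq i j; first by rewrite mulr1n.
      by rewrite mulr0n (bigD1 i) //= subrr mul0r.
    rewrite det_diag; apply: eq_bigr => i _; rewrite mxE big_mkcond /=.
    by apply: eq_bigr => j _; rewrite /g; case: eqP.
  rewrite prod_pairs_lt => [|i]; last by rewrite /g eqxx.
  apply: eq_bigr => i _; apply: eq_bigr => j lt_ij.
  have ne_ij : i != j by rewrite neq_ltn lt_ij.
  by rewrite /g eq_sym (negPf ne_ij) mulrC.
rewrite factor det_mulmx det_tr detV detM -big_split /=.
by apply: eq_bigr => i _; rewrite -big_split.
Qed.

(** A pair [i, j] with both or neither index in [K] contributes [1] on the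
    right; a pair split by [K] contributes the left-hand factor whichever of the
    two indices is smaller, because [(x j - x i) / (w j - w i)] is symmetric in
    [i] and [j]. *)
Lemma Vandermonde_shift_ratio (C : fieldType) (n : nat) (w : 'I_n -> C) (d : C)
    (K : {set 'I_n}) (x := fun i => if i \in K then w i - d else w i) :
  (forall i j, i != j -> w i - w j != 0) ->
  \prod_(i in K) \prod_(j | j \notin K) ((w i - w j - d) / (w i - w j))
    = \prod_(i < n) \prod_(j < n | (i < j)%N) ((x j - x i) / (w j - w i)).
Proof.
move=> w_inj.
pose g i j := if (i \in K) && (j \notin K)
              then (w i - w j - d) / (w i - w j) else 1.
transitivity (\prod_(i < n) \prod_(j < n) g i j).
  rewrite big_mkcond; apply: eq_bigr => i _ /=; rewrite /g.
  case: (i \in K) => /=; last by rewrite big1_eq.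
  by rewrite big_mkcond.
rewrite prod_pairs_lt => [|i]; last by rewrite /g andbN.
apply: eq_bigr => i _; apply: eq_bigr => j lt_ij.
have wji : w j - w i != 0 by apply: w_inj; rewrite eq_sym neq_ltn lt_ij.
rewrite /g /x; case: (i \in K); case: (j \in K) => /=.
- by rewrite opprB addrA subrK mulr1 divff.
- rewrite mulr1 -mulrNN -invrN !opprB; congr (_ / _).
  by rewrite addrCA.
- by rewrite mul1r addrAC.
- by rewrite mulr1 divff.
Qed.

Lemma sum_subsets_det (C : fieldType) (n : nat) (w eta t : 'I_n -> C) (d : C) :
  (forall i j, i != j -> w i - w j != 0) ->
  (forall i j, i != j -> eta i - eta j != 0) ->
  \sum_(K : {set 'I_n})
      (\prod_(i in K) t i)
      * \prod_(i in K) \prod_(j | j \notin K) ((w i - w j - d) / (w i - w j))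
    = 1 / (\prod_(i < n) \prod_(j < n | (i < j)%N)
             ((w j - w i) * (eta i - eta j)))
      * \det (\matrix_(i < n, j < n)
          (\prod_(k < n | k != j) (w i - eta k)
           + t i * \prod_(k < n | k != j) (w i - d - eta k))).
Proof.
move=> w_inj eta_inj.
set D := \prod_(i < n) _.
have Dn0 : D != 0.
  apply/prodf_neq0 => i _; apply/prodf_neq0 => j lt_ij.
  have ne_ij : i != j by rewrite neq_ltn lt_ij.
  by rewrite mulf_neq0 ?eta_inj // w_inj // eq_sym.
apply: (mulfI Dn0); rewrite mul1r mulVKf // mulr_sumr.
pose A : 'M[C]_n := \matrix_(i, j) \prod_(k < n | k != j) (w i - eta k).
pose B : 'M[C]_n :=
  \matrix_(i, j) (t i * \prod_(k < n | k != j) (w i - d - eta k)).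
transitivity (\det (A + B)); last first.
  by congr (\det _); apply/matrixP=> i j; rewrite !mxE.
rewrite det_row_addE; apply: eq_bigr => K _.
pose x i := if i \in K then w i - d else w i.
pose r := \row_i (if i \in K then t i else 1).
have -> : \matrix_(i, j) (if i \in K then B i j else A i j)
    = diag_mx r *m \matrix_(i, j) \prod_(k < n | k != j) (x i - eta k).
  apply/matrixP=> i j; rewrite mul_diag_mx !mxE /x.
  by case: (i \in K); rewrite ?mul1r.
rewrite det_mulmx det_diag det_nodal // mulrCA; congr (_ * _).
  by rewrite [LHS]big_mkcond; apply: eq_bigr => i _; rewrite mxE.
rewrite Vandermonde_shift_ratio // /D -big_split; apply: eq_bigr => i _ /=.
rewrite -big_split; apply: eq_bigr => j lt_ij /=.
have wji : w j - w i != 0 by apply: w_inj; rewrite eq_sym neq_ltn lt_ij.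
by rewrite mulrC mulrA divfK.
Qed.

(** The shape shared by F and G: the weight is [- z * a i], whose constant
    factor is collected into [(- z) ^+ #|K|]. *)
Lemma sum_subsets_pow_det (C : fieldType) (n : nat) (w eta a : 'I_n -> C)
    (d z : C) :
  (forall i j, i != j -> w i - w j != 0) ->
  (forall i j, i != j -> eta i - eta j != 0) ->
  \sum_(K : {set 'I_n})
      (- z) ^+ #|K|
      * (\prod_(i in K) \prod_(j | j \notin K) ((w i - w j - d) / (w i - w j)))
      * \prod_(i in K) a i
    = 1 / (\prod_(i < n) \prod_(j < n | (i < j)%N)
             ((w j - w i) * (eta i - eta j)))
      * \det (\matrix_(i < n, j < n)
          (\prod_(k < n | k != j) (w i - eta k)
           - z * (\prod_(k < n | k != j) (w i - eta k - d)) * a i)).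
Proof.
move=> w_inj eta_inj.
transitivity (\sum_(K : {set 'I_n}) (\prod_(i in K) (- z * a i))
    * \prod_(i in K) \prod_(j | j \notin K) ((w i - w j - d) / (w i - w j))).
  by apply: eq_bigr => K _; rewrite big_split prodr_const /= mulrAC.
rewrite (sum_subsets_det (fun i => - z * a i) d w_inj eta_inj).
congr (_ * \det _); apply/matrixP=> i j; rewrite !mxE; congr (_ + _).
rewrite mulrAC !mulNr; congr (- (_ * _ * _)).
by apply: eq_bigr => k _; rewrite addrAC.
Qed.

Theorem corollary4p5 (R : realType) (m n : nat) (hm : (0 < m)%N) (hn : (0 < n)%N)
    (c z : complex R) (u : 'I_n -> complex R) (v : 'I_m -> complex R)
    (huv : forall (i : 'I_m) (k : 'I_n), v i - u k - c != 0)
    (hz : (m < n)%N -> z != 1) :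
  ((forall i j : 'I_m, i != j -> v i - v j != 0) ->
   forall eta : 'I_m -> complex R,
   (forall i j : 'I_m, i != j -> eta i - eta j != 0) ->
   sourceF c z u v =
     1 / (\prod_(i < m) \prod_(j < m | (i < j)%N)
            ((v j - v i) * (eta i - eta j)))
     * \det (\matrix_(i < m, j < m)
         (\prod_(k < m | k != j) (v i - eta k)
          - z * (\prod_(k < m | k != j) (v i - eta k - c))
              * (\prod_(k < n) ((v i - u k) / (v i - u k - c))))))
  /\
  ((forall i j : 'I_n, i != j -> u i - u j != 0) ->
   forall eta : 'I_n -> complex R,
   (forall i j : 'I_n, i != j -> eta i - eta j != 0) ->
   sourceG c z u v =
     (1 - z) ^ (m%:Z - n%:Z)
     * (1 / (\prod_(i < n) \prod_(j < n | (i < j)%N)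
               ((u j - u i) * (eta i - eta j))))
     * \det (\matrix_(i < n, j < n)
         (\prod_(k < n | k != j) (u i - eta k)
          - z * (\prod_(k < n | k != j) (u i - eta k + c))
              * (\prod_(k < m) ((u i - v k) / (u i - v k + c)))))).
Proof.
split=> [v_inj | u_inj] eta eta_inj.
  exact: (sum_subsets_pow_det _ c z v_inj eta_inj).
rewrite /sourceG -mulrA; congr (_ * _).
have := sum_subsets_pow_det
  (fun i => \prod_(k < m) ((u i - v k) / (u i - v k + c)))
  (- c) z u_inj eta_inj.
by rewrite opprK.
Qed.
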